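(* Let $\mathbb{F}_q$ be a finite field with $q$ elements, and let $A,B\subseteq \mathbb{F}_q$ satisfy $|A|\,|B|>q$. Then $10AB=\mathbb{F}_q$.
   Context: For $A,B\subseteq\mathbb{F}_q$, $AB=\{ab: a\in A,\ b\in B\}$, and for a set $S\subseteq \mathbb{F}_q$ and $d\in\mathbb{N}$, $dS=S+\dots+S$ ($d$ times) denotes the $d$-fold sumset $\{s_1+\dots+s_d: s_i\in S\}$. Thus $10AB$ is the set of all sums $a_1b_1+\dots+a_{10}b_{10}$ with $a_i\in A$, $b_i\in B$. *)

(* Defs.v *)
From HB Require Import structures.
From mathcomp Require Import all_boot all_order all_algebra.
Set Implicit Arguments.
Unset Strict Implicit.
Unset Printing Implicit Defensive.
Import GRing.Theory.
Local Open Scope ring_scope.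

Definition prodset (F : finFieldType) (A B : {set F}) : {set F} :=
  [set a * b | a in A, b in B].

(* The summands may repeat; for d = 0 this is [set 0]. *)
Definition sumset (F : finFieldType) (d : nat) (S : {set F}) : {set F} :=
  [set \sum_(i < d) s i | s : {ffun 'I_d -> F} in ffun_on (mem S)].

(* Main.v *)
Require Import Defs.
From HB Require Import structures.
From mathcomp Require Import all_boot all_order all_algebra.
From mathcomp Require Import zify ring.
Set Implicit Arguments.
Unset Strict Implicit.
Unset Printing Implicit Defensive.
Import GRing.Theory.

(**
Shrink A until (|A| - 1)(|B| - 1) <= q - 1, keeping |A||B| > q.  Averaging then
yields xi <> 0 for which (a, b) |-> a - xi b has at most 2|A||B| collisions
(diagonal ones included) on A x B; swapping b and b' gives as few for -xi, so A - xi B and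
A + xi B both have more than q/2 elements.  If xi = u / v with u a sum of i
elements of A, v a sum of j elements of B and i + j <= 5, then
v (A + xi B) is contained in v A + u B, hence, up to a translation, in 5AB, and
10AB = F by pigeonhole.

Otherwise put Y = A - xi B, A0 = A /\ -A, B0 = B /\ -B, A1 = A \ A0,
B1 = B \ B0.  As Y + Y = F, each -a (resp. -b) is a sum of two elements of A
(resp. B), for otherwise xi would be such a ratio with i + j = 5.  Therefore
any nontrivial collision has both pairs in A1 x B1.  For i = j = 2 one
gets that Y /\ -Y lies in A0 - xi B0, so 2|Y| <= q + |A0||B0|.  Hence the
image of A1 x B1 is so small that, by Cauchy-Schwarz, it carries more
collisions than xi allows.
*)

(** * Cauchy-Schwarz and collision counts *)

Lemma sqr_sum_leq_card (I : finType) (P : {pred I}) (r : I -> nat) :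
  ((\sum_(i in P) r i) ^ 2 <= #|P| * \sum_(i in P) r i ^ 2)%N.
Proof.
(* Doubling turns both sides into double sums over P x P, compared termwise by 2xy <= x^2 + y^2. *)
rewrite -(leq_pmul2l (isT : 0 < 2)%N).
have -> : (2 * (\sum_(i in P) r i) ^ 2 =
          \sum_(i in P) \sum_(j in P) 2 * (r i * r j))%N.
  rewrite -mulnn big_distrlr big_distrr /=.
  by apply: eq_bigr => i _; rewrite big_distrr.
have -> : (2 * (#|P| * \sum_(i in P) r i ^ 2) =
          \sum_(i in P) \sum_(j in P) (r i ^ 2 + r j ^ 2))%N.
  under [RHS]eq_bigr => i _ do rewrite big_split /= sum_nat_const.
  by rewrite big_split /= -big_distrr sum_nat_const /= mul2n addnn.
by apply: leq_sum => i _; apply: leq_sum => j _; apply: nat_Cauchy.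
Qed.

Definition coll (T U : finType) (f : T -> U) (D : {set T}) : {set T * T} :=
  [set p in setX D D | f p.1 == f p.2].

Lemma in_coll (T U : finType) (f : T -> U) (D : {set T}) p :
  (p \in coll f D) = [&& p.1 \in D, p.2 \in D & f p.1 == f p.2].
Proof. by rewrite !inE andbA. Qed.

Lemma card_coll (T U : finType) (f : T -> U) (D : {set T}) :
  #|coll f D| = (\sum_(x in D) \sum_(x' in D) (f x == f x'))%N.
Proof.
rewrite pair_big /= -sum1_card big_mkcond [RHS]big_mkcond /=.
apply: eq_bigr => -[x y] _; rewrite !inE /=.
by case: (x \in D); case: (y \in D); case: (f x == f y).
Qed.

(** Cauchy-Schwarz for the fibre sizes [r y]: they sum to [#|D|] and their squares to
    [#|coll f D|]. *)
Lemma card_sqr_leq_coll (T U : finType) (f : T -> U) (D : {set T}) :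
  (#|D| ^ 2 <= #|f @: D| * #|coll f D|)%N.
Proof.
pose r y := #|[set x in D | f x == y]|.
have rE y : r y = (\sum_(x in D) (f x == y))%N.
  rewrite /r -sum1_card big_mkcond [RHS]big_mkcond /=.
  by apply: eq_bigr => x _; rewrite inE; case: (x \in D); case: (f x == y).
have sum1 (G : U -> nat) :
    (\sum_(x in D) G (f x) = \sum_(y in f @: D) r y * G y)%N.
  rewrite (partition_big_imset f) /=; apply: eq_bigr => y _.
  rewrite /r -sum1_card big_distrl /= big_mkcond [RHS]big_mkcond /=.
  apply: eq_bigr => x _; rewrite inE; case: (x \in D) => //=.
  by case: eqP => // ->; rewrite mul1n.
have -> : #|D| = (\sum_(y in f @: D) r y)%N.
  rewrite -sum1_card (sum1 (fun=> 1%N)).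
  by apply: eq_bigr => y _; rewrite muln1.
have -> : #|coll f D| = (\sum_(y in f @: D) r y ^ 2)%N.
  rewrite card_coll exchange_big /=.
  under eq_bigr do rewrite -rE.
  by rewrite sum1; apply: eq_bigr => y _; rewrite mulnn.
exact: sqr_sum_leq_card.
Qed.

(** * Sumsets and pigeonhole *)

Section Sumsets.

Local Open Scope ring_scope.

Variable F : finFieldType.
Implicit Types (A B S X Y : {set F}) (x y z xi : F).

Lemma sumset1 S x : x \in S -> x \in sumset 1 S.
Proof.
move=> xS; apply/imsetP; exists [ffun=> x]; last by rewrite big_ord1 ffunE.
by apply/ffun_onP => i; rewrite ffunE.
Qed.

Lemma sumsetD d e S x y :
  x \in sumset d S -> y \in sumset e S -> x + y \in sumset (d + e) S.
Proof.
case/imsetP => s /ffun_onP sS -> /imsetP[t /ffun_onP tS ->].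
apply/imsetP; exists [ffun i => match split i with inl j => s j | inr j => t j end].
  by apply/ffun_onP => i; rewrite ffunE; case: (split i) => j; [apply: sS | apply: tS].
rewrite big_split_ord /=; congr (_ + _); apply: eq_bigr => i _; rewrite ffunE.
- by rewrite -[lshift _ _]/(unsplit (inl i)) unsplitK.
- by rewrite -[rshift _ _]/(unsplit (inr i)) unsplitK.
Qed.

(** [X] and the reflected set z - Y are together too large to be disjoint. *)
Lemma add_large_sets X Y z : (#|F| < #|X| + #|Y|)%N ->
  exists x y, [/\ x \in X, y \in Y & z = x + y].
Proof.
move=> large; pose Z := [set z - y | y in Y].
have cZ : #|Z| = #|Y| by apply: card_imset => u v /addrI/oppr_inj.
have: X :&: Z != set0.
  have := cardsUI X Z; have := subset_leq_card (subsetT (X :|: Z)).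
  rewrite cZ cardsT -card_gt0; move: large; move: #|F|%N => q; lia.
case/set0Pn => x; rewrite inE => /andP[xX /imsetP[y yY xE]].
by exists x, y; split=> //; rewrite xE subrK.
Qed.

(** * Collisions of linear forms *)

Definition line xi (p : F * F) : F := p.1 - xi * p.2.

(* a - xi b = a' - xi b' iff a + xi b' = a' + xi b. *)
Lemma card_collN A B xi :
  (#|coll (line (- xi)) (setX A B)| <= #|coll (line xi) (setX A B)|)%N.
Proof.
pose g (p : (F * F) * (F * F)) := ((p.1.1, p.2.2), (p.2.1, p.1.2)).
have g_inj : injective g by move=> [[a b] [c d]] [[a' b'] [c' d']] [-> -> -> ->].
rewrite -(card_imset _ g_inj); apply/subset_leq_card/subsetP => _ /imsetP[[[a b] [c d]] + ->].
rewrite !inE /line /= => /andP[/andP[/andP[-> ->] /andP[-> ->]]] /eqP e.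
apply/eqP; have -> : a - xi * d = a - (- xi) * b - xi * b - xi * d by ring.
by rewrite e; ring.
Qed.

(** Sum the counts over all xi <> 0. For a fixed p, taking p' = p contributes q - 1; a p' differing
    from p in both coordinates collides with it for at most one xi, any other p' for none. By
    hypothesis the total is at most 2(q - 1)|A||B|. *)
Lemma exists_few_coll A B : (#|A|.-1 * #|B|.-1 <= #|F|.-1)%N ->
  exists2 xi, xi != 0 &
    (#|coll (line xi) (setX A B)| <= 2 * (#|A| * #|B|))%N.
Proof.
move=> hAB; set D := setX A B.
have F1 : #|[pred xi : F | xi != 0]| = #|F|.-1 by rewrite -(cardC1 (0 : F)).
have F_gt1 := card_finRing_gt1 F.
apply/exists_inP; apply: contraT => /exists_inPn many.
suff: (\sum_(xi : F | xi != 0%R) #|coll (line xi) D| <= #|F|.-1 * (2 * #|D|))%N.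
  have : (\sum_(xi : F | xi != 0%R) (2 * #|D|).+1 <=
          \sum_(xi : F | xi != 0%R) #|coll (line xi) D|)%N.
    apply: leq_sum => xi xi0; rewrite cardsX ltnNge; exact: many.
  move=> h1 h2; have := leq_trans h1 h2.
  by rewrite sum_nat_const F1 leq_pmul2l ?ltnn // -subn1 subn_gt0.
under eq_bigr do rewrite card_coll.
rewrite exchange_big /= mulnA mulnC [(#|F|.-1 * 2)%N]mulnC -sum_nat_const.
apply: leq_sum => p pD; rewrite exchange_big /= (bigD1 p) //= mulSn mul1n.
apply: leq_add.
  by under eq_bigr do rewrite eqxx; rewrite sum1_card F1.
apply: leq_trans hAB.
move: pD; rewrite inE => /andP[p1A p2B].
have -> : (#|A|.-1 * #|B|.-1 = #|setX (A :\ p.1) (B :\ p.2)|)%N.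
  by rewrite cardsX (cardsD1 p.1 A) p1A (cardsD1 p.2 B) p2B.
rewrite -sum1_card big_mkcond [leqRHS]big_mkcond /=; apply: leq_sum => p' _.
case: ifP => // /andP[]; rewrite !inE => /andP[p'A p'B] neq.
have small (xi : F) : xi != 0 -> line xi p = line xi p' ->
    p'.1 != p.1 /\ p'.2 != p.2 /\ xi = (p.1 - p'.1) / (p.2 - p'.2).
  move=> xi0; rewrite /line => e.
  have e' : p.1 - p'.1 = xi * (p.2 - p'.2).
    have -> : p.1 - p'.1 = p.1 - xi * p.2 + xi * p.2 - p'.1 by ring.
    by rewrite e; ring.
  have n2 : p.2 - p'.2 != 0.
    apply: contra_neq neq => z2; move: e'; rewrite z2 mulr0.
    move=> /eqP; rewrite subr_eq0 => /eqP z1; move/eqP: z2.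
    rewrite subr_eq0 => /eqP z2.
    by rewrite [p']surjective_pairing -z1 -z2 -surjective_pairing.
  split; first by rewrite eq_sym -subr_eq0 e' mulf_neq0.
  by split; [rewrite eq_sym -subr_eq0 | rewrite e' mulfK].
have -> : (\sum_(xi : F | xi != 0%R) (line xi p == line xi p') =
           #|[set xi : F | (xi != 0%R) && (line xi p == line xi p')]|)%N.
  rewrite -sum1_card big_mkcond [RHS]big_mkcond /=; apply: eq_bigr => xi _.
  by rewrite inE; case: (xi != 0); case: (_ == _).
rewrite p'A p'B !andbT; case: ifP => [_ | /negP far].
  apply/card_le1_eqP => xi xi'; rewrite !inE.
  move=> /andP[/small sx /eqP/sx[_ [_ ->]]] /andP[/small sx' /eqP/sx'[_ [_ ->]]].
  by [].
rewrite leqn0 cards_eq0; apply/set0Pn => -[xi]; rewrite inE.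
by case/andP => /small sx /eqP/sx[n1 [n2 _]]; case: far; rewrite n1 n2.
Qed.

Lemma large_line_image A B xi : (#|F| < #|A| * #|B|)%N ->
  (#|coll (line xi) (setX A B)| <= 2 * (#|A| * #|B|))%N ->
  (#|F| < 2 * #|line xi @: setX A B|)%N.
Proof.
move=> hAB hE; apply: leq_trans hAB _.
have := card_sqr_leq_coll (line xi) (setX A B); rewrite cardsX; nia.
Qed.

(** The affine map x -> v x + c is injective and carries A + xi B, the image of [line (- xi)], into
    [S]. The shift c later pads sums of four products to five. *)
Lemma card_line_dilate A B S xi v c : v != 0 ->
  {in A & B, forall a b, v * (a + xi * b) + c \in S} ->
  (#|line (- xi) @: setX A B| <= #|S|)%N.
Proof.
move=> v0 sub; have inj : injective (fun x => v * x + c).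
  by move=> x y /addIr; apply: mulfI.
rewrite -(card_imset _ inj); apply/subset_leq_card/subsetP.
move=> _ /imsetP[_ /imsetP[[a b] + ->] ->]; rewrite inE => /andP[aA bB].
by rewrite /line mulNr opprK; apply: sub.
Qed.

Lemma mem_sumset5 S x1 x2 x3 x4 x5 : x1 \in S -> x2 \in S -> x3 \in S ->
  x4 \in S -> x5 \in S -> x1 + (x2 + (x3 + (x4 + x5))) \in sumset 5 S.
Proof.
move=> m1 m2 m3 m4 m5.
by do 4!(apply: (@sumsetD 1); first exact: sumset1); exact: sumset1.
Qed.

(* [a0], [a1], [b0], [b1] are the sizes of A0, A1, B0, B1; [y] and [e1] are the
   size of the image of A1 x B1 and the number of its collisions. *)
Lemma arith_contradiction (q a0 a1 b0 b1 y Y e e1 : nat) :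
  (q < (a0 + a1) * (b0 + b1))%N ->
  (e <= 2 * ((a0 + a1) * (b0 + b1)))%N ->
  (e1 + (a0 * b0 + a0 * b1 + a1 * b0) <= e)%N ->
  (a0 * b0 + a0 * b1 + a1 * b0 + y <= Y)%N ->
  (2 * Y <= q + a0 * b0)%N ->
  ((a1 * b1) ^ 2 <= y * e1)%N -> False.
Proof.
pose X := (a1 * b1)%N; pose M := (a0 * b1 + a1 * b0)%N; pose N := (a0 * b0)%N.
have -> : ((a0 + a1) * (b0 + b1) = N + M + X)%N by rewrite /N /M /X; lia.
(* [N * X] is the product of the two summands of [M]. *)
have MNX : (N * X <= M * M)%N by rewrite /N /M /X; nia.
move=> hq he he1 hY hYq hcs.
have {hcs} : (X * X <= y * e1)%N by rewrite /X mulnn.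
have hy : (2 * y + M < X)%N by rewrite /X /M /N in hq hYq *; lia.
have hE : (e1 <= 2 * X + M + N)%N by rewrite /X /M /N in he *; lia.
clearbody X M N; clear - MNX hy hE.
have : (y * e1 <= y * (2 * X + M + N))%N by rewrite leq_mul2l hE orbT.
(* As 2y < X - M, one gets 2 y e1 < (X - M)(2X + M + N) = 2X^2 - XM - MN + (NX - M^2) <= 2X^2. *)
nia.
Qed.

(** * The case where xi is not a ratio of short sums *)

Section NoRatio.

Variables (A B : {set F}) (xi : F).
Hypotheses (hAB : (#|F| < #|A| * #|B|)%N)
  (hE : (#|coll (line xi) (setX A B)| <= 2 * (#|A| * #|B|))%N).
(** The digits count the summands from [A] and from [B]. A vanishing denominator remains possible,
    and the proofs below draw relations such as b1 + b2 = 0 from it. *)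
Hypotheses
  (ratio22 : forall a1 a2 b1 b2, a1 \in A -> a2 \in A -> b1 \in B -> b2 \in B ->
     xi * (b1 + b2) = a1 + a2 -> b1 + b2 = 0)
  (ratio32 : forall a1 a2 a3 b1 b2, a1 \in A -> a2 \in A -> a3 \in A ->
     b1 \in B -> b2 \in B -> xi * (b1 + b2) = a1 + a2 + a3 -> b1 + b2 = 0)
  (ratio23 : forall a1 a2 b1 b2 b3, a1 \in A -> a2 \in A ->
     b1 \in B -> b2 \in B -> b3 \in B ->
     xi * (b1 + b2 + b3) = a1 + a2 -> b1 + b2 + b3 = 0).

Let D := setX A B.
Let Y := line xi @: D.
Let A0 := [set a in A | - a \in A].
Let B0 := [set b in B | - b \in B].

Let add_image z : exists a1 a2 b1 b2,
  [/\ a1 \in A, a2 \in A, b1 \in B & b2 \in B] /\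
  z = (a1 + a2) - xi * (b1 + b2).
Proof.
have large : (#|F| < #|Y| + #|Y|)%N.
  by rewrite addnn -mul2n; exact: large_line_image.
have [_ [_ [/imsetP[[a1 b1] + ->] /imsetP[[a2 b2] + ->] ->]]] :=
  add_large_sets z large.
rewrite !inE /= => /andP[? ?] /andP[? ?].
by exists a1, a2, b1, b2; split; [split | rewrite /line /=; ring].
Qed.

(** Represent -a in Y + Y: then xi (b1 + b2) = a1 + a2 + a, and [ratio32] kills the xi term. *)
Let oppA a : a \in A -> exists a1 a2, [/\ a1 \in A, a2 \in A & - a = a1 + a2].
Proof.
move=> aA; have [a1 [a2 [b1 [b2 [[a1A a2A b1B b2B] e]]]]] := add_image (- a).
have b0 : b1 + b2 = 0.
  apply: (ratio32 (a1 := a1) (a2 := a2) (a3 := a)) => //.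
  by rewrite -[a]opprK e; ring.
by exists a1, a2; split=> //; rewrite e b0 mulr0 subr0.
Qed.

(** Here xi b is the element represented, so that xi (b1 + b2 + b) = a1 + a2 and [ratio23]
    applies. *)
Let oppB b : b \in B -> exists b1 b2, [/\ b1 \in B, b2 \in B & - b = b1 + b2].
Proof.
move=> bB; have [a1 [a2 [b1 [b2 [[a1A a2A b1B b2B] e]]]]] := add_image (xi * b).
have b0 : b1 + b2 + b = 0.
  apply: (ratio23 (a1 := a1) (a2 := a2)) => //.
  by rewrite mulrDr e; ring.
by exists b1, b2; split=> //; apply/eqP; rewrite eq_sym -addr_eq0 b0.
Qed.

(** A collision gives xi (b' - b) = a' - a. If -a lies in A, write -b as a sum of two elements of B
    and use [ratio23]; if -b lies in B, split -a and use [ratio32]. Either way b' = b. *)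
Let line_inj p p' : p \in D -> p' \in D -> (p.1 \in A0) || (p.2 \in B0) ->
  line xi p = line xi p' -> p = p'.
Proof.
case: p p' => [a b] [a' b']; rewrite !inE /line /= => /andP[aA bB] /andP[a'A b'B] h e.
have d0 : b' - b = 0.
  have ed : xi * (b' - b) = a' - a.
    have -> : a' - a = a' - xi * b' + xi * b' - a by ring.
    by rewrite -e; ring.
  case/orP: h => /andP[_ Nin].
    have [b1 [b2 [b1B b2B bE]]] := oppB bB.
    rewrite bE addrA.
    by apply: (ratio23 (a1 := a') (a2 := - a)) => //; rewrite -addrA -bE.
  have [a1 [a2 [a1A a2A aE]]] := oppA aA.
  by apply: (ratio32 (a1 := a') (a2 := a1) (a3 := a2)) => //; rewrite -addrA -aE.
have bb : b' = b by apply/eqP; rewrite -subr_eq0 d0.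
by move: e; rewrite bb => /addIr->.
Qed.

Lemma no_ratio_false : False.
Proof.
pose A1 := A :\: A0; pose B1 := B :\: B0; pose D1 := setX A1 B1.
have cA : #|A| = (#|A0| + #|A1|)%N.
  by rewrite -(cardsID A0 A); congr (_ + _)%N; apply: eq_card => a; rewrite !inE; case: (a \in A).
have cB : #|B| = (#|B0| + #|B1|)%N.
  by rewrite -(cardsID B0 B); congr (_ + _)%N; apply: eq_card => a; rewrite !inE; case: (a \in B).
have D1D : D1 \subset D by apply: setXS; apply: subsetDl.
have cDD : #|D :\: D1| = (#|A0| * #|B0| + #|A0| * #|B1| + #|A1| * #|B0|)%N.
  have := cardsID D1 D; rewrite (setIidPr D1D) !cardsX cA cB; lia.
have symD p : p \in D :\: D1 -> (p.1 \in A0) || (p.2 \in B0).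
  by rewrite !inE; case: (p.1 \in A); case: (p.2 \in B); rewrite //= !andbT;
     case: (- p.1 \in A); case: (- p.2 \in B).
apply: (@arith_contradiction #|F| #|A0| #|A1| #|B0| #|B1| #|line xi @: D1| #|Y|
  #|coll (line xi) D| #|coll (line xi) D1|).
- by rewrite -cA -cB.
- by rewrite -cA -cB.
(* The diagonal over D \ D1 is disjoint from the collisions inside D1. *)
- have dinj : injective (fun p : F * F => (p, p)) by move=> p p' [->].
  rewrite -cDD -(card_imset _ dinj) -cardsUI.
  set X := _ :&: _; have -> : X = set0.
    apply/setP => p; rewrite !inE; apply/negP => /andP[/andP[/andP[p1 _] _]].
    by case/imsetP => p' + pE; move: p1; rewrite pE /= !inE => ->.
  rewrite cards0 addn0; apply/subset_leq_card/subsetP => p; rewrite in_setU.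
  case/orP.
    by rewrite !in_coll => /and3P[/(subsetP D1D)-> /(subsetP D1D)-> ->].
  by case/imsetP => p' /setDP[p'D _] ->; rewrite in_coll /= p'D eqxx.
(* By [line_inj] the map is injective on D \ D1, and no value there is taken on D1. *)
- rewrite -cDD.
  have <- : #|line xi @: (D :\: D1)| = #|D :\: D1|.
    apply: card_in_imset => p p' pD p'D; apply: line_inj; last exact: symD.
      by case/setDP: pD.
    by case/setDP: p'D.
  rewrite -cardsUI; set X := _ :&: _; have -> : X = set0.
    apply/setP => y; rewrite inE in_set0; apply/negP => /andP[/imsetP[p pD ->]].
    case/imsetP => p' p'D1 e; case/setDP: (pD) => pD' /negP[].
    by rewrite (line_inj pD' (subsetP D1D _ p'D1) (symD _ pD) e).
  by rewrite cards0 addn0 -imsetU setUC setDE setUIr setUCr setIT (setUidPr D1D).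
(* Inclusion-exclusion for Y and -Y: by [ratio22], a common value a - xi b = -(a' - xi b') forces a'
   = -a and b' = -b, so (a, b) lies in A0 x B0. *)
- have <- : #|setX A0 B0| = (#|A0| * #|B0|)%N by rewrite cardsX.
  have cN : #|-%R @: Y| = #|Y| by apply: card_imset; apply: oppr_inj.
  have -> : (2 * #|Y| = #|Y| + #|-%R @: Y|)%N by rewrite cN addnn mul2n.
  rewrite -cardsUI; apply: leq_add; first by rewrite -cardsT subset_leq_card ?subsetT.
  apply: leq_trans (leq_imset_card (line xi) _).
  apply/subset_leq_card/subsetP => y; rewrite inE => /andP[/imsetP[[a b] + ->]].
  rewrite inE /= => /andP[aA bB] /imsetP[_ /imsetP[[a' b'] + ->]].
  rewrite inE /= => /andP[a'A b'B]; rewrite /line /= => e.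
  have e' : xi * (b + b') = a + a'.
    by rewrite -[a](subrK (xi * b)) e; ring.
  have b0 := ratio22 aA a'A bB b'B e'.
  have a0 : a + a' = 0 by rewrite -e' b0 mulr0.
  apply/imsetP; exists (a, b) => //; rewrite !inE aA bB /=.
  by move/eqP: b0; move/eqP: a0; rewrite !addr_eq0 => /eqP-> /eqP->; rewrite !opprK a'A.
- by have := card_sqr_leq_coll (line xi) D1; rewrite cardsX.
Qed.

End NoRatio.

(** * Short sums of products fill over half the field *)

Lemma large_sumset5 A B : (#|F| < #|A| * #|B|)%N ->
  (#|A|.-1 * #|B|.-1 <= #|F|.-1)%N ->
  (#|F| < 2 * #|sumset 5 (prodset A B)|)%N.
Proof.
move=> hAB hred; have [xi _ hE] := exists_few_coll hred.
rewrite ltnNge; apply/negP => small.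
have memP a b : a \in A -> b \in B -> a * b \in prodset A B.
  by move=> aA bB; apply/imset2P; exists a b.
(* Were v nonzero, A + xi B, which has more than q/2 elements, would embed in 5AB, against
   [small]. *)
have key v c : {in A & B, forall a b,
    v * (a + xi * b) + c \in sumset 5 (prodset A B)} -> v = 0.
  move=> sub; apply/eqP; apply: contraLR small => v0; rewrite -ltnNge.
  apply: leq_trans (large_line_image (xi := - xi) hAB _) _; last first.
    by rewrite leq_mul2l (card_line_dilate v0 sub).
  exact: leq_trans (card_collN _ _ _) hE.
apply: (no_ratio_false hAB hE).
(* Four products suffice since xi (b1 + b2) = a1 + a2; the shift a1 b1 supplies a fifth. *)
- move=> a1 a2 b1 b2 a1A a2A b1B b2B e; apply: (key _ (a1 * b1)) => a b aA bB.
  have -> : (b1 + b2) * (a + xi * b) + a1 * b1 =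
      a * b1 + (a * b2 + (a1 * b + (a2 * b + a1 * b1))).
    have -> : (b1 + b2) * (a + xi * b) = (b1 + b2) * a + xi * (b1 + b2) * b by ring.
    by rewrite e; ring.
  by apply: mem_sumset5; apply: memP.
- move=> a1 a2 a3 b1 b2 a1A a2A a3A b1B b2B e; apply: (key _ 0) => a b aA bB.
  have -> : (b1 + b2) * (a + xi * b) + 0 =
      a * b1 + (a * b2 + (a1 * b + (a2 * b + a3 * b))).
    have -> : (b1 + b2) * (a + xi * b) = (b1 + b2) * a + xi * (b1 + b2) * b by ring.
    by rewrite e; ring.
  by apply: mem_sumset5; apply: memP.
- move=> a1 a2 b1 b2 b3 a1A a2A b1B b2B b3B e; apply: (key _ 0) => a b aA bB.
  have -> : (b1 + b2 + b3) * (a + xi * b) + 0 =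
      a * b1 + (a * b2 + (a * b3 + (a1 * b + a2 * b))).
    have -> : (b1 + b2 + b3) * (a + xi * b) =
        (b1 + b2 + b3) * a + xi * (b1 + b2 + b3) * b by ring.
    by rewrite e; ring.
  by apply: mem_sumset5; apply: memP.
Qed.

(** Take A' minimal with |A'| n > q and put k = |A'| - 1. Deleting an element gives k n <= q, so k
    (n - 1) <= q - k <= q - 1 if k > 0; for k = 0 the product is 0. *)
Lemma subset_threshold A n : (#|F| < #|A| * n)%N ->
  exists2 A' : {set F}, A' \subset A &
    (#|F| < #|A'| * n)%N && (#|A'|.-1 * n.-1 <= #|F|.-1)%N.
Proof.
move=> hA; have [] := arg_minnP (P := fun A' : {set F} =>
  (A' \subset A) && (#|F| < #|A'| * n)%N) (fun A' => #|A'|) (i0 := A).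
  by rewrite subxx.
move=> A' /andP[A'A hA'] minA'; exists A' => //; rewrite hA' /=.
have /set0Pn[a aA'] : A' != set0.
  by apply: contraTneq hA' => ->; rewrite cards0.
have : ~~ (#|F| < #|A' :\ a| * n)%N.
  apply/negP => h; have := minA' (A' :\ a).
  rewrite h (subset_trans (subsetDl _ _) A'A) => /(_ isT).
  by rewrite (cardsD1 a A') aA' ltnn.
have := card_finRing_gt1 F.
rewrite (cardsD1 a A') aA' -leqNgt add1n /=.
case: #|A' :\ a| => [|k]; case: n {hA hA' minA'} => [|n] //=; nia.
Qed.

Lemma sumset10_full A B : (#|F| < #|A| * #|B|)%N ->
  sumset 10 (prodset A B) = [set: F].
Proof.
move=> hAB; have [A' A'A /andP[hA'B hred]] := subset_threshold hAB.
have large := large_sumset5 hA'B hred.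
apply/setP => z; rewrite inE.
have := large; rewrite mul2n -addnn => /(@add_large_sets _ _ z)[x [y [xS yS ->]]].
have sub : {subset sumset 5 (prodset A' B) <= sumset 5 (prodset A B)}.
  apply/subsetP/imsetS/subsetP => s /ffun_onP sP; apply/ffun_onP => i.
  by move: (sP i); apply: subsetP; apply: imset2Sl.
by apply: (@sumsetD 5 5); apply: sub.
Qed.

End Sumsets.

Theorem theorem1 (F : finFieldType) (q : nat) (hq : #|F| = q)
    (A B : {set F}) (hAB : q < #|A| * #|B|) :
  sumset 10 (prodset A B) = [set: F].
Proof. by apply: sumset10_full; rewrite hq. Qed.
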